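(* Let $\rho_0=|\psi_0\rangle\langle\psi_0|$ and $\rho_1=|\psi_1\rangle\langle\psi_1|$ be two pure states, where $\psi_0,\psi_1$ are unit vectors in a finite-dimensional complex Hilbert space. Let $R$ be the minimal average error probability for deciding between $\rho_0$ and $\rho_1$ (each with prior probability $1/2$) by a joint measurement of $N$ identical copies of the state. Then $$R=\frac12\left(1-\sqrt{1-|\langle\psi_0|\psi_1\rangle|^{2N}}\right).$$ Asymptotically, $$R\sim\frac14\,|\langle\psi_0|\psi_1\rangle|^{2N}\quad\text{as }N\to\infty.$$
   Context: A state on a finite-dimensional complex Hilbert space $H$ is a positive semidefinite operator of trace $1$; it is pure if it has rank one. A measurement on a Hilbert space is a finite family $\{M_i\}$ of positive semidefinite operators summing to the identity; when applied to a state $\rho$, outcome $i$ occurs with probability $\operatorname{tr}(M_i\rho)$. A joint measurement of $N$ copies is a measurement on $H^{\otimes N}$ applied to $\rho_0^{\otimes N}$ or $\rho_1^{\otimes N}$. After observing the outcome, a decision rule chooses $\rho_0$ or $\rho_1$. The average error probability is $\frac12 \Pr(\text{choose }\rho_1\mid\rho_0)+\frac12\Pr(\text{choose }\rho_0\mid\rho_1)$, and $R$ (which depends on $N$) is its minimum over all joint measurements and decision rules. By the Holevo–Helstrom theorem, $R=\frac12\left(1-\frac12\|\rho_0^{\otimes N}-\rho_1^{\otimes N}\|_1\right)$, where $\|A\|_1$ is the sum of absolute values of the eigenvalues of the Hermitian operator $A$. The notation $a_N\sim b_N$ means $a_N=b_N(1+o(1))$ as $N\to\infty$.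
   Formalization: The asymptotic claim is stated only for distinct states ρ₀ ≠ ρ₁; if ρ₀ = ρ₁ then R = 1/2 for every N while the right-hand side is 1/4, so the claim fails there. *)

(* Defs.v *)
From HB Require Import structures.
From mathcomp Require Import all_boot all_order all_algebra.
From mathcomp Require Import all_classical all_reals all_analysis.
From mathcomp Require Import sesquilinear spectral.
From mathcomp Require Export complex.
(* Not imported: its notation [A ^t k] clashes with the one of sesquilinear.v *)
From mathcomp Require mxtens.

Set Implicit Arguments.
Unset Strict Implicit.
Unset Printing Implicit Defensive.

Import Order.TTheory GRing.Theory Num.Theory.
Import numFieldNormedType.Exports.

Local Open Scope classical_set_scope.
Local Open Scope ring_scope.
Local Open Scope sesquilinear_scope.

(* A d-dimensional complex Hilbert space is R[i]^d with its standard inner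
   product, antilinear in the first argument; operators are matrices. *)

Definition braket (R : realType) d (u v : 'cV[R[i]]_d) : R[i] :=
  (u ^t* *m v) 0 0.

Definition ketbra (R : realType) d (u : 'cV[R[i]]_d) : 'M[R[i]]_d :=
  u *m u ^t*.

Definition overlap (R : realType) d (u v : 'cV[R[i]]_d) : R :=
  Normc.normc (braket u v).

(* The order of R[i] makes [0 <= z] mean that z is real and nonnegative. *)
Definition psdmx (R : realType) d (A : 'M[R[i]]_d) : Prop :=
  A \is hermsymmx /\ forall v : 'cV[R[i]]_d, 0 <= braket v (A *m v).

Definition measurement (R : realType) d (I : finType) (M : I -> 'M[R[i]]_d)
    : Prop :=
  (forall i, psdmx (M i)) /\ \sum_i M i = 1%:M.

(* The trace is real when rho and the effect E are positive semidefinite. *)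
Definition outcome_prob (R : realType) d (E rho : 'M[R[i]]_d) : R :=
  complex.Re (\tr (E *m rho)).

(* Probability that the decision rule f chooses hypothesis b, where false
   stands for rho0 and true for rho1, when the measured state is rho. *)
Definition choice_prob (R : realType) d (I : finType) (M : I -> 'M[R[i]]_d)
    (f : I -> bool) (rho : 'M[R[i]]_d) (b : bool) : R :=
  \sum_(i | f i == b) outcome_prob (M i) rho.

Definition avg_error (R : realType) d (I : finType) (M : I -> 'M[R[i]]_d)
    (f : I -> bool) (rho0 rho1 : 'M[R[i]]_d) : R :=
  2^-1 * choice_prob M f rho0 true + 2^-1 * choice_prob M f rho1 false.

(* [mxtens.ntensmx rho N] is the N-th tensor power of rho, acting on
   the space (R[i]^d)^{(x) N} = R[i]^(d ^ N). *)
Definition joint_errors (R : realType) d (rho0 rho1 : 'M[R[i]]_d) (N : nat)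
    : set R :=
  [set e | exists (I : finType) (M : I -> 'M[R[i]]_(d ^ N)) (f : I -> bool),
     measurement M /\
     e = avg_error M f (mxtens.ntensmx rho0 N) (mxtens.ntensmx rho1 N)].

(* Minimality proper, i.e. that the infimum is attained, is to be asserted
   separately. *)
Definition min_error (R : realType) d (rho0 rho1 : 'M[R[i]]_d) (N : nat) : R :=
  inf (joint_errors rho0 rho1 N).

(* Landau equivalence along \oo is a_N = b_N (1 + o(1)), also when some b_N
   vanish. *)
Lemma equiv_seqP (R : realType) (a b : nat -> R^o) :
  a ~_\oo b <->
  exists2 e : nat -> R^o, e @ \oo --> (0 : R^o) &
    \forall N \near \oo, a N = b N * (1 + e N).
Proof.
split=> [/eqaddoP ab|[e e0 eE]].
- exists (fun N => (a N - b N) / b N).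
    apply/cvgr0Pnorm_le => eps eps0.
    have := ab _ eps0; apply: filterS => N /= abN.
    have [->|b0] := eqVneq (b N) 0; first by rewrite invr0 mulr0 normr0 ltW.
    by rewrite normrM normfV ler_pdivrMr ?normr_gt0.
  have := ab _ ltr01; apply: filterS => N.
  rewrite -[(a - b) N]/(a N - b N).
  have [->|b0 _] := eqVneq (b N) 0.
    by rewrite normr0 mulr0 normr_le0 subr_eq0 mul0r => /eqP aN; rewrite aN.
  by rewrite mulrDr mulr1 mulrCA divff // mulr1 addrC subrK.
- apply/eqaddoP => eps eps0.
  move/cvgr0Pnorm_le: e0 => /(_ _ eps0); apply: filterS2 eE => N /= aE eN.
  rewrite [X in `|X|](_ : _ = b N * e N); last first.
    by rewrite -[LHS]/(a N - b N) aE mulrDr mulr1 addrC addKr.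
  by rewrite normrM mulrC ler_wpM2r.
Qed.

(* Main.v *)
Require Import Defs.
From mathcomp Require Import all_boot all_order all_algebra.
From mathcomp Require Import all_classical all_reals all_analysis.
From mathcomp Require Import sesquilinear ring lra.
From mathcomp Require mxtens.
Import Order.TTheory GRing.Theory Num.Theory.
Import numFieldNormedType.Exports.

Local Open Scope classical_set_scope.
Local Open Scope ring_scope.
Local Open Scope sesquilinear_scope.

(* For unit vectors u, v put z = <u|v>, s = sqrt (1 - |z|^2),
   w = (1 + s) v - z u and w' = (1 + s) u - z^* v. Up to scaling these are the
   eigenvectors of |v><v| - |u><u| for the eigenvalues s and -s, and
     |w><w| - |w'><w'| = 2 s (1 + s) (|v><v| - |u><u|),
     <w|w> = 2 s^2 (1 + s).
   Hence <v|E v> - <u|E u> <= s whenever 0 <= E <= 1, with equality when E is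
   the projector onto w. This gives the optimal error (1 - s) / 2 for a pair of
   pure states; tensor powers of pure states are pure, with overlap z^N.
   For the asymptotics, (1 - s) / 2 = (|z|^2 / 4) (1 + (1 - s) / (1 + s)). *)

(** * Algebra of inner products and rank-one operators *)

Section Braket.
Variables (R : realType) (d : nat).
Implicit Types (u v w : 'cV[R[i]]_d) (A E : 'M[R[i]]_d).

Lemma braketE u v : braket u v = \sum_k (u k 0)^* * v k 0.
Proof. by rewrite /braket mxE; apply: eq_bigr => k _; rewrite !mxE. Qed.

Lemma braketC u v : braket v u = (braket u v)^*.
Proof.
rewrite !braketE rmorph_sum; apply: eq_bigr => k _.
by rewrite rmorphM /= conjCK mulrC.
Qed.

Lemma braket0r u : braket u 0 = 0.
Proof. by rewrite /braket mulmx0 mxE. Qed.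

Lemma braketDr u v w : braket u (v + w) = braket u v + braket u w.
Proof. by rewrite /braket mulmxDr mxE. Qed.

Lemma braketNr u v : braket u (- v) = - braket u v.
Proof. by rewrite /braket mulmxN mxE. Qed.

Lemma braketZr a u v : braket u (a *: v) = a * braket u v.
Proof. by rewrite /braket -scalemxAr mxE. Qed.

Lemma braketDl u v w : braket (v + w) u = braket v u + braket w u.
Proof. by rewrite braketC braketDr rmorphD /= -!braketC. Qed.

Lemma braketNl u v : braket (- v) u = - braket v u.
Proof. by rewrite braketC braketNr rmorphN /= -braketC. Qed.

Lemma braketZl a u v : braket (a *: v) u = a^* * braket v u.
Proof. by rewrite braketC braketZr rmorphM /= -braketC. Qed.

Definition braket_lin :=
  (braketDr, braketNr, braketZr, braketDl, braketNl, braketZl).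

Lemma braket_ge0 u : 0 <= braket u u.
Proof. by rewrite braketE sumr_ge0 // => k _; rewrite mulrC mul_conjC_ge0. Qed.

Lemma braket_eq0 u : (braket u u == 0) = (u == 0).
Proof.
rewrite braketE psumr_eq0 => [|k _]; last by rewrite mulrC mul_conjC_ge0.
apply/allP/eqP => [u0|-> k _]; last by rewrite /= mxE mulr0.
apply/matrixP => k j; rewrite (ord1 j) mxE.
have := u0 k (mem_index_enum k).
by rewrite /= mulrC mul_conjC_eq0 => /eqP.
Qed.

Lemma ketbra_mul u v : ketbra u *m v = braket u v *: u.
Proof. by rewrite /ketbra -mulmxA [_ *m v]mx11_scalar mul_mx_scalar. Qed.

Lemma ketbra_herm u : ketbra u \is hermsymmx.
Proof.
apply/is_hermitianmxP/matrixP => j k; rewrite expr0 scale1r !mxE rmorph_sum.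
by apply: eq_bigr => l _; rewrite !mxE rmorphM /= conjCK mulrC.
Qed.

Lemma ketbraZ a u : ketbra (a *: u) = (a * a^*) *: ketbra u.
Proof.
apply/matrixP => j k; rewrite !mxE mulr_sumr; apply: eq_bigr => l _.
by rewrite !mxE rmorphM mulrACA.
Qed.

Lemma outcome_prob_ketbra E u :
  outcome_prob E (ketbra u) = complex.Re (braket u (E *m u)).
Proof. by rewrite /outcome_prob /ketbra mulmxA mxtrace_mulC trace_mx11. Qed.

(** * Cauchy-Schwarz and its equality case *)

(** Here [x] is the component of [v] orthogonal to [u], scaled by [braket u u] to avoid division.
    Nonnegativity of its squared norm yields Cauchy-Schwarz; its vanishing settles the equality
    case. *)
Lemma braket_residual u v :
  let x := braket u u *: v - braket u v *: u in
  braket x x =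
  braket u u * (braket u u * braket v v - braket u v * (braket u v)^*).
Proof.
rewrite /= !braket_lin (braketC u v) -(braketC u u).
by ring.
Qed.

Lemma cauchy_schwarz u v :
  braket u v * (braket u v)^* <= braket u u * braket v v.
Proof.
have [->|u0] := eqVneq u 0.
  by rewrite (braketC v 0) !braket0r conjC0 !mul0r.
have uu : 0 < braket u u by rewrite lt_def braket_eq0 u0 braket_ge0.
by rewrite -subr_ge0 -(pmulr_rge0 _ uu) -braket_residual braket_ge0.
Qed.

Lemma overlap_sqrC u v :
  ((overlap u v ^+ 2)%:C)%C = braket u v * (braket u v)^*.
Proof. by rewrite -normCK rmorphXn. Qed.

Lemma overlap_ge0 u v : 0 <= overlap u v.
Proof. by rewrite /overlap; case: braket => a b; rewrite sqrtr_ge0. Qed.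

Lemma overlap_sqr_le1 u v :
  braket u u = 1 -> braket v v = 1 -> overlap u v ^+ 2 <= 1.
Proof.
move=> u1 v1; have := cauchy_schwarz u v.
by rewrite u1 v1 mulr1 -overlap_sqrC lecR.
Qed.

(** At overlap 1 the residual vanishes, so [v] is [u] times a phase, and [ketbra] does not see
    phases. *)
Lemma overlap_lt1 u v : braket u u = 1 -> braket v v = 1 ->
  ketbra u <> ketbra v -> overlap u v < 1.
Proof.
move=> u1 v1 uv; rewrite lt_neqAle -(@expr_le1 _ 2) ?overlap_ge0 //.
rewrite overlap_sqr_le1 // andbT; apply/eqP => o1; apply: uv.
have := overlap_sqrC u v; rewrite o1 expr1n rmorph1 => zz.
have := braket_residual u v; rewrite /= u1 v1 -zz !mul1r subrr scale1r.
move/eqP; rewrite braket_eq0 subr_eq0 => /eqP ->.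
by rewrite ketbraZ -zz scale1r.
Qed.

(** * Optimal effect for a pair of unit vectors *)

(** For unit vectors, half the trace norm of [ketbra v - ketbra u]. *)
Definition helstrom_gap u v : R := Num.sqrt (1 - overlap u v ^+ 2).

Lemma helstrom_gap_ge0 u v : 0 <= helstrom_gap u v.
Proof. exact: sqrtr_ge0. Qed.

Lemma helstrom_gap_sqrC u v : braket u u = 1 -> braket v v = 1 ->
  braket u v * (braket u v)^* = 1 - ((helstrom_gap u v)%:C)%C ^+ 2.
Proof.
move=> u1 v1; rewrite -rmorphXn /= sqr_sqrtr ?subr_ge0 ?overlap_sqr_le1 //.
by rewrite rmorphB rmorph1 /= overlap_sqrC subKr.
Qed.

Lemma conjC_real (s : R) : (s%:C)%C^* = (s%:C)%C.
Proof. by apply: conj_Creal; rewrite complex_real. Qed.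

Definition helstrom_vec u v : 'cV[R[i]]_d :=
  (1 + ((helstrom_gap u v)%:C)%C) *: v - braket u v *: u.

Lemma overlapC u v : overlap v u = overlap u v.
Proof.
rewrite /overlap (braketC u v); case: braket => a b.
by rewrite /= sqrrN.
Qed.

(** The cross terms between [u] and [v] cancel for every [E]. What remains has coefficient (1 + s)^2
    - |z|^2, and |z|^2 = 1 - s^2. *)
Lemma helstrom_vec_braket E u v : braket u u = 1 -> braket v v = 1 ->
  let s : R[i] := ((helstrom_gap u v)%:C)%C in
  let w := helstrom_vec u v in let w' := helstrom_vec v u in
  braket w (E *m w) - braket w' (E *m w') =
  2 * s * (1 + s) * (braket v (E *m v) - braket u (E *m u)).
Proof.
move=> u1 v1 s w w'; rewrite /w /w' /helstrom_vec.
have -> : helstrom_gap v u = helstrom_gap u v by rewrite /helstrom_gap overlapC.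
have zz := helstrom_gap_sqrC _ _ u1 v1.
rewrite (braketC u v) !mulmxDr !mulmxN -!scalemxAr !braket_lin.
rewrite !rmorphD !rmorph1 /= conjC_real conjCK -/s.
set z := braket u v in zz *.
transitivity (((1 + s) ^+ 2 - z * z^*) *
              (braket v (E *m v) - braket u (E *m u))); first by ring.
by rewrite zz; ring.
Qed.

Lemma helstrom_vec_norm u v : braket u u = 1 -> braket v v = 1 ->
  let s : R[i] := ((helstrom_gap u v)%:C)%C in let w := helstrom_vec u v in
  [/\ braket w w = 2 * s ^+ 2 * (1 + s), braket v w = s * (1 + s) &
    braket u w = s * braket u v].
Proof.
move=> u1 v1 s w; have zz := helstrom_gap_sqrC _ _ u1 v1.
rewrite /w /helstrom_vec !braket_lin u1 v1 (braketC u v).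
rewrite !rmorphD !rmorph1 /= conjC_real -/s.
set z := braket u v in zz *; set zc := z^* in zz *.
split; last by ring.
- transitivity ((1 + s) ^+ 2 + z * zc - 2 * (1 + s) * (z * zc)); first by ring.
  by rewrite zz; ring.
- transitivity (1 + s - z * zc); first by ring.
  by rewrite zz; ring.
Qed.

(** Bound <w|E w> by <w|w> = 2 s (1 + s) s, drop <w'|E w'> >= 0, and cancel the factor 2 s (1 +
    s). *)
Lemma helstrom_effect_le u v E : braket u u = 1 -> braket v v = 1 ->
  (forall x, 0 <= braket x (E *m x) <= braket x x) ->
  braket v (E *m v) - braket u (E *m u) <= ((helstrom_gap u v)%:C)%C.
Proof.
move=> u1 v1 E01; have := helstrom_vec_braket E _ _ u1 v1.
have [ww vw uw] := helstrom_vec_norm _ _ u1 v1.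
set s : R[i] := ((helstrom_gap u v)%:C)%C in ww vw uw *.
set w := helstrom_vec _ _ in ww vw uw *.
move=> /= wE; have s_ge0 : 0 <= s by rewrite ler0c helstrom_gap_ge0.
(* At s = 0 that factor cannot be cancelled; but then w = 0, so [v] is [u] times a phase and both
   expectations agree. *)
have [s0|sn0] := eqVneq s 0.
  have w0 : w = 0 by apply/eqP; rewrite -braket_eq0 ww s0 expr0n mulr0 mul0r.
  have vE : v = braket u v *: u.
    apply/eqP; rewrite -subr_eq0 -w0 /w /helstrom_vec.
    by rewrite -/s s0 addr0 scale1r.
  have zz := helstrom_gap_sqrC _ _ u1 v1.
  rewrite vE -scalemxAr !braket_lin mulrA [_^* * _]mulrC zz -/s s0.
  by rewrite expr0n subr0 mul1r subrr.
have s_gt0 : 0 < s by rewrite lt_def sn0.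
have k0 : 0 < 2 * s * (1 + s) by rewrite !mulr_gt0 ?addr_gt0.
rewrite -(ler_pM2l k0) -wE.
have /andP[_ le1] := E01 w; have /andP[ge0 _] := E01 (helstrom_vec v u).
rewrite (_ : _ * (1 + s) * s = braket w w); last by rewrite ww; ring.
by rewrite lerBlDr (le_trans le1) // lerDl.
Qed.

(* With the convention 0^-1 = 0, this is 0 when the two states coincide, and
   then every effect is optimal. *)
Definition helstrom_effect u v : 'M[R[i]]_d :=
  let w := helstrom_vec u v in (braket w w)^-1 *: ketbra w.

Lemma helstrom_effectE u v x :
  let w := helstrom_vec u v in
  braket x (helstrom_effect u v *m x) =
  (braket w w)^-1 * (braket w x * (braket w x)^*).
Proof.
rewrite /= -scalemxAl ketbra_mul; set w := helstrom_vec u v.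
by rewrite !braketZr (braketC w x).
Qed.

(** The upper bound is Cauchy-Schwarz for w and [x]; if w = 0, the effect is 0. *)
Lemma helstrom_effect_bounds u v x :
  0 <= braket x (helstrom_effect u v *m x) <= braket x x.
Proof.
rewrite helstrom_effectE; set w := helstrom_vec u v.
rewrite mulr_ge0 ?invr_ge0 ?braket_ge0 ?mul_conjC_ge0 //=.
have [w0|w0] := eqVneq (braket w w) 0.
  by rewrite w0 invr0 mul0r braket_ge0.
have ww : 0 < braket w w by rewrite lt_def w0 braket_ge0.
by rewrite ler_pdivrMl // cauchy_schwarz.
Qed.

(** For s nonzero, the difference is s^2 ((1 + s)^2 - |z|^2) / (2 s^2 (1 + s)) = s. *)
Lemma helstrom_effect_gap u v : braket u u = 1 -> braket v v = 1 ->
  braket v (helstrom_effect u v *m v) - braket u (helstrom_effect u v *m u) =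
  ((helstrom_gap u v)%:C)%C.
Proof.
move=> u1 v1; rewrite !helstrom_effectE.
have [ww vw uw] := helstrom_vec_norm _ _ u1 v1.
rewrite ww -mulrBr !(braketC _ (helstrom_vec u v)) vw uw !conjCK.
have zz := helstrom_gap_sqrC _ _ u1 v1.
rewrite !rmorphM rmorphD /= rmorph1 !conjC_real.
set s : R[i] := ((helstrom_gap u v)%:C)%C in zz *.
have [->|s0] := eqVneq s 0; first by rewrite expr0n /= !(mulr0, mul0r, invr0).
have s1 : 1 + s != 0.
  rewrite gt_eqF // (lt_le_trans ltr01) // lerDl.
  by rewrite ler0c helstrom_gap_ge0.
transitivity ((2 * s ^+ 2 * (1 + s))^-1 *
  (s ^+ 2 * ((1 + s) ^+ 2 - braket u v * (braket u v)^*))); first by ring.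
by rewrite zz; field; rewrite s1 s0.
Qed.

(** * From measurements with decision rules to single effects *)

(** Both [E] and its complement, the sum over the outcomes rejected by [f], are sums of positive
    semidefinite operators. *)
Lemma sum_effects_bounds (I : finType) (M : I -> 'M[R[i]]_d) (f : I -> bool) :
  measurement M -> let E := \sum_(i | f i) M i in
  forall x, 0 <= braket x (E *m x) <= braket x x.
Proof.
move=> [Mpsd M1] E x.
have pos (P : pred I) : 0 <= braket x ((\sum_(i | P i) M i) *m x).
  rewrite mulmx_suml; elim/big_ind: _ => [|y z y0 z0|i _].
  - by rewrite braket0r.
  - by rewrite braketDr addr_ge0.
  - by case: (Mpsd i).
rewrite pos -subr_ge0 -braketNr -braketDr -{2}[x]mul1mx -M1 -mulmxBl.
by rewrite (bigID f) /= addrC addrK pos.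
Qed.

Lemma choice_prob_ketbra (I : finType) (M : I -> 'M[R[i]]_d) f u b :
  choice_prob M f (ketbra u) b =
  complex.Re (braket u ((\sum_(i | f i == b) M i) *m u)).
Proof.
rewrite mulmx_suml; rewrite /choice_prob; elim/big_rec2: _ => [|i x y _ ->].
  by rewrite braket0r.
by rewrite braketDr raddfD outcome_prob_ketbra.
Qed.

(** Minimizing the error thus amounts to maximizing <v|E v> - <u|E u> over effects. *)
Lemma avg_error_ketbra (I : finType) (M : I -> 'M[R[i]]_d) f u v :
  measurement M -> braket v v = 1 -> let E := \sum_(i | f i) M i in
  avg_error M f (ketbra u) (ketbra v) =
  2^-1 * (1 - complex.Re (braket v (E *m v) - braket u (E *m u))).
Proof.
move=> [_ M1] v1 E; rewrite /avg_error !choice_prob_ketbra.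
rewrite (eq_bigl f) => [|i]; last by rewrite eqb_id.
have -> : \sum_(i | f i == false) M i = 1%:M - E.
  rewrite -M1 [in RHS](bigID f) /= addrAC subrr add0r.
  by apply: eq_bigl => i; case: (f i).
rewrite mulmxBl mul1mx braketDr braketNr v1 !raddfB /=.
by lra.
Qed.

Lemma avg_error_ge (I : finType) (M : I -> 'M[R[i]]_d) f u v :
  measurement M -> braket u u = 1 -> braket v v = 1 ->
  2^-1 * (1 - helstrom_gap u v) <= avg_error M f (ketbra u) (ketbra v).
Proof.
move=> mM u1 v1; rewrite avg_error_ketbra //.
have := helstrom_effect_le _ _ _ u1 v1 (sum_effects_bounds _ _ f mM).
by rewrite lecE => /andP[_]; rewrite ler_pM2l ?invr_gt0 // lerD2l lerN2.
Qed.

Lemma hermsymmxB A B :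
  A \is hermsymmx -> B \is hermsymmx -> A - B \is hermsymmx.
Proof.
move=> /is_hermitianmxP hA /is_hermitianmxP hB; apply/is_hermitianmxP.
by rewrite {1}hA {1}hB !expr0 !scale1r linearB /= map_mxB.
Qed.

Lemma helstrom_effect_herm u v : helstrom_effect u v \is hermsymmx.
Proof.
apply/is_hermitianmxP; rewrite expr0 scale1r /helstrom_effect.
rewrite linearZ /= map_mxZ.
have /is_hermitianmxP := ketbra_herm (helstrom_vec u v).
rewrite expr0 scale1r => <-; congr (_ *: _).
by rewrite fmorphV /= -braketC.
Qed.

Lemma avg_error_attained u v : braket u u = 1 -> braket v v = 1 ->
  exists (I : finType) (M : I -> 'M[R[i]]_d) f, measurement M /\
  2^-1 * (1 - helstrom_gap u v) = avg_error M f (ketbra u) (ketbra v).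
Proof.
move=> u1 v1; pose E := helstrom_effect u v.
(* The outcomes are the decisions themselves, so the rule is the identity. *)
exists bool, (fun b : bool => if b then E else 1%:M - E), id.
have mM : measurement (fun b : bool => if b then E else 1%:M - E).
  split=> [b|]; last by rewrite big_bool /= addrC subrK.
  have E_herm : E \is hermsymmx by exact: helstrom_effect_herm.
  case: b; split; first exact: E_herm.
  - by move=> x; have /andP[] := helstrom_effect_bounds u v x.
  - exact: hermsymmxB (hermitian1mx_subproof _) E_herm.
  - move=> x; rewrite mulmxBl mul1mx braketDr braketNr subr_ge0.
    by have /andP[] := helstrom_effect_bounds u v x.
split=> //; rewrite avg_error_ketbra //.
by rewrite big_mkcond big_bool /= addr0 helstrom_effect_gap.
Qed.

End Braket.

(** * Tensor powers of pure states *)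

(** An instance of the mixed-product rule. The ascriptions read the [1 * 1] columns of [tensmx] as a
    single one. *)
Lemma braket_tens (R : realType) m n (u u' : 'cV[R[i]]_m) (v v' : 'cV[R[i]]_n) :
  braket (mxtens.tensmx u v : 'cV_(m * n)) (mxtens.tensmx u' v' : 'cV_(m * n)) =
  braket u u' * braket v v'.
Proof.
transitivity ((mxtens.tensmx (u ^t* *m u') (v ^t* *m v') : 'M[R[i]]_1) 0 0).
  by rewrite -mxtens.tensmx_mul -mxtens.map_mxT -mxtens.trmx_tens.
by rewrite /mxtens.tensmx mxE; congr (_ * _); congr (_ _ _); apply: ord1.
Qed.

Lemma ketbra_tens (R : realType) m n (u : 'cV[R[i]]_m) (v : 'cV[R[i]]_n) :
  ketbra (mxtens.tensmx u v : 'cV_(m * n)) =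
  mxtens.tensmx (ketbra u) (ketbra v).
Proof.
by rewrite /ketbra -mxtens.tensmx_mul -mxtens.map_mxT -mxtens.trmx_tens.
Qed.

Lemma ntensmx_ketbra (R : realType) d (u v : 'cV[R[i]]_d) N :
  exists U V : 'cV[R[i]]_(d ^ N),
  [/\ mxtens.ntensmx (ketbra u) N = ketbra U,
      mxtens.ntensmx (ketbra v) N = ketbra V,
      braket U U = braket u u ^+ N, braket V V = braket v v ^+ N &
      braket U V = braket u v ^+ N].
Proof.
(* The recursion [ntensmxSS] relates powers from 1 on, so the powers 0 and 1 are separate base
   cases. *)
case: N => [|N].
  exists 1%:M, 1%:M; rewrite /ketbra /braket trmx1 map_mx1 mulmx1 mxE eqxx.
  by split.
elim: N => [|N [U [V [UE VE UU VV UV]]]]; first by exists u, v.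
exists (mxtens.tensmx u U), (mxtens.tensmx v V).
rewrite !ketbra_tens !braket_tens UU VV UV -!exprS -UE -VE.
by rewrite !mxtens.ntensmxSS.
Qed.

(** * Asymptotics of the optimal error *)

Lemma helstrom_error_equiv (R : realType) (c : R) : 0 <= c < 1 ->
  (fun N : nat => 2^-1 * (1 - Num.sqrt (1 - c ^+ (2 * N))) : R^o) ~_\oo
  (fun N : nat => 4^-1 * c ^+ (2 * N) : R^o).
Proof.
move=> /andP[c0 c1]; apply/equiv_seqP.
pose t N := Num.sqrt (1 - c ^+ (2 * N)).
have x0 N : 0 <= c ^+ (2 * N) by rewrite exprn_ge0.
have x1 N : c ^+ (2 * N) <= 1 by rewrite exprn_ile1 // ltW.
have t0 N : 0 <= t N by exact: sqrtr_ge0.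
have t2 N : t N ^+ 2 = 1 - c ^+ (2 * N) by rewrite sqr_sqrtr // subr_ge0.
have t1 N : 0 < 1 + t N by rewrite ltr_pwDl.
(* Since c^(2N) = (1 - t)(1 + t), the ratio of the two sequences is 2 / (1 + t) = 1 + (1 - t) / (1 +
   t) wherever c^(2N) is nonzero. *)
exists (fun N => (1 - t N) / (1 + t N)); last first.
  apply: nearW => N; rewrite -/(t N).
  have -> : c ^+ (2 * N) = 1 - t N ^+ 2 by rewrite t2 subKr.
  by field; rewrite gt_eqF.
have tle N : t N <= 1 by rewrite -(@expr_le1 _ 2) // t2 gerBl.
(* The chain is (1 - t) / (1 + t) <= 1 - t <= 1 - t^2 = c^(2N) <= c^N, and c^N tends to 0 as c <
   1. *)
apply: (@squeeze_cvgr _ _ _ _ (fun=> 0) (fun N => c ^+ N)); last 2 first.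
- exact: cvg_cst.
- by apply: cvg_expr; rewrite ger0_norm.
apply: nearW => N; rewrite divr_ge0 ?subr_ge0 ?tle ?(ltW (t1 N)) //=.
apply: (@le_trans _ _ (1 - t N)).
  by rewrite ler_pdivrMr // ler_peMr ?subr_ge0 ?tle // lerDl.
apply: (@le_trans _ _ (c ^+ (2 * N))).
  rewrite -[c ^+ _](subKr 1) -t2 lerD2l lerN2 expr2 ler_piMr //.
by rewrite mul2n -addnn exprD ler_piMr ?exprn_ge0 ?exprn_ile1 // ltW.
Qed.

Theorem theorem4p2 (R : realType) (d : nat) (psi0 psi1 : 'cV[R[i]]_d)
    (hpsi0 : braket psi0 psi0 = 1) (hpsi1 : braket psi1 psi1 = 1) :
  let rho0 := ketbra psi0 in
  let rho1 := ketbra psi1 in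
  let Rmin : nat -> R^o := min_error rho0 rho1 in
  (forall N : nat, joint_errors rho0 rho1 N (Rmin N) /\
                   lbound (joint_errors rho0 rho1 N) (Rmin N)) /\
  (forall N : nat,
     Rmin N = 2^-1 * (1 - Num.sqrt (1 - overlap psi0 psi1 ^+ (2 * N)))) /\
  (rho0 <> rho1 ->
     Rmin ~_\oo (fun N : nat => 4^-1 * overlap psi0 psi1 ^+ (2 * N) : R^o)).
Proof.
move=> rho0 rho1 Rmin.
pose r N : R := 2^-1 * (1 - Num.sqrt (1 - overlap psi0 psi1 ^+ (2 * N))).
have opt N : joint_errors rho0 rho1 N (r N) /\
             lbound (joint_errors rho0 rho1 N) (r N).
  have [U [V [UE VE UU VV UV]]] := ntensmx_ketbra _ _ psi0 psi1 N.
  rewrite hpsi0 expr1n in UU; rewrite hpsi1 expr1n in VV.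
  have -> : r N = 2^-1 * (1 - helstrom_gap _ _ U V).
    rewrite /r /helstrom_gap; congr (_ * (_ - Num.sqrt (_ - _))).
    (* Compared inside [R[i]], where a squared overlap is z z^* and powers distribute over the
       product. *)
    apply: complexI; rewrite overlap_sqrC UV exprM [LHS]rmorphXn /=.
    by rewrite overlap_sqrC rmorphXn exprMn.
  split=> [|_ [I [M [f [mM ->]]]]].
    by rewrite /joint_errors /= UE VE; exact: avg_error_attained.
  by rewrite UE VE; exact: avg_error_ge.
have RminE N : Rmin N = r N.
  (* A lower bound that belongs to the set is its infimum. *)
  have [rN lbN] := opt N; apply/eqP; rewrite eq_le /Rmin /min_error.
  by rewrite ge_inf ?lb_le_inf //; [exists (r N)|exists (r N)].
split; first by move=> N; rewrite RminE.
split=> [|rho01]; first exact: RminE.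
rewrite (_ : Rmin = r); last exact/funext.
(* Distinctness of the states enters here, as overlap < 1. *)
by apply: helstrom_error_equiv; rewrite overlap_ge0 overlap_lt1.
Qed.
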